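(* Let $PG(2,q)$ be a projective plane of order $q>1$, and let $HC(PG(2,q))$ be the hypergraph whose vertices are the points of the plane and whose hyperedges are the Hamiltonian circuits of the associated rank-$3$ matroid, i.e. its circuits of size $4$. Then $hc(HC(PG(2,q)))=q+3$.
   Context: A projective plane of order $q$ is viewed as the rank-$3$ simple matroid on its points whose rank-$2$ flats are the lines; its circuits are the sets of $3$ collinear points and the sets of $4$ points with no three collinear. A Hamiltonian circuit of a rank-$r$ matroid is a circuit of size $r+1$; here these are the sets of $4$ points with no three collinear. For an integer $t\ge 1$, a $t$-colouring of a hypergraph $H=(V,E)$ is a surjective function $\phi:V\to\{1,\dots,t\}$ (all colours must be used). A $t$-colouring $\phi$ is heterochromatic if there is a hyperedge $e\in E$ whose vertices receive pairwise distinct colours under $\phi$ (a totally multicoloured hyperedge). The heterochromatic number $hc(H)$ is the minimum $t\ge 1$ such that every $t$-colouring of $H$ is heterochromatic. *)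

(* Defs.v *)
From mathcomp Require Import all_boot.

Set Implicit Arguments.
Unset Strict Implicit.
Unset Printing Implicit Defensive.

Record matroid (T : finType) := Matroid {
  indep : {set T} -> bool;
  indep0 : indep set0;
  indepS : forall A B : {set T}, A \subset B -> indep B -> indep A;
  indep_aug : forall A B : {set T}, indep A -> indep B -> #|A| < #|B| ->
    exists2 x, x \in B :\: A & indep (x |: A)
}.

Section Matroid.
Variables (T : finType) (M : matroid T).

Definition mrank (A : {set T}) : nat :=
  \max_(I : {set T} | (I \subset A) && indep M I) #|I|.

Definition circuit (C : {set T}) : bool := minset (fun A => ~~ indep M A) C.

Definition flat (F : {set T}) : bool :=
  [forall x, (x \notin F) ==> (mrank F < mrank (x |: F))].

Definition simple_matroid : Prop := forall C, circuit C -> 2 < #|C|.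

Definition hamiltonian_circuit (C : {set T}) : bool :=
  circuit C && (#|C| == (mrank setT).+1).

Lemma leq_mrank (I A : {set T}) : I \subset A -> indep M I -> #|I| <= mrank A.
Proof.
by move=> sIA iI; rewrite /mrank (bigD1 I) ?sIA ?iI //= leq_max leqnn.
Qed.

Lemma mrank_leq n (A : {set T}) :
  (forall I : {set T}, I \subset A -> indep M I -> #|I| <= n) -> mrank A <= n.
Proof. by move=> h; apply/bigmax_leqP => I /andP[]; apply: h. Qed.

Lemma mrank_witness (A : {set T}) :
  exists I : {set T}, [/\ I \subset A, indep M I & #|I| = mrank A].
Proof.
have P0 : (set0 \subset A) && indep M set0 by rewrite sub0set indep0.
pose p := [pred I : {set T} | (I \subset A) && indep M I].
have [I /andP[sIA iI] E] := @eq_bigmax_cond _ p (fun I : {set T} => #|I|)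
  (introT card_gt0P (ex_intro _ set0 P0)).
by exists I; split=> //; rewrite /mrank -E.
Qed.

End Matroid.

(* The vertex set is the whole type [T]; the value is the set of hyperedges. *)
Definition hypergraph (T : finType) := {set {set T}}.

Definition colouring (T : finType) (t : nat) (phi : {ffun T -> 'I_t}) : bool :=
  [forall c, exists v, phi v == c].

Definition heterochromatic (T : finType) (H : hypergraph T) (t : nat)
    (phi : {ffun T -> 'I_t}) : bool :=
  [exists e in H, dinjectiveb phi (mem e)].

Definition all_heterochromatic (T : finType) (H : hypergraph T) (t : nat) : bool :=
  [forall phi : {ffun T -> 'I_t}, colouring phi ==> heterochromatic H phi].

(* The set of which [hc] is the minimum is not empty: it contains [#|T|.+1],
   for which there is no surjective colouring at all. *)
Lemma hc_exists (T : finType) (H : hypergraph T) :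
  exists t, (0 < t) && all_heterochromatic H t.
Proof.
exists #|T|.+1; rewrite /=; apply/forallP => phi; apply/implyP => /forallP sphi.
suff : #|'I_(#|T|.+1)| <= #|T| by rewrite card_ord ltnn.
apply: leq_trans (max_card (mem [set: T])).
apply: leq_trans (leq_imset_card phi _).
rewrite -[X in X <= _]cardsT; apply/subset_leq_card/subsetP => c _.
by have /existsP[v /eqP <-] := sphi c; rewrite imset_f ?inE.
Qed.

Definition hc (T : finType) (H : hypergraph T) : nat := ex_minn (hc_exists H).

Definition HC (T : finType) (M : matroid T) : hypergraph T :=
  [set C | hamiltonian_circuit M C].

Record projective_plane (T : finType) := ProjectivePlane {
  lines : {set {set T}};
  line_through : forall x y : T, x != y ->
    exists! l : {set T}, [/\ l \in lines, x \in l & y \in l];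
  line_meet : forall l m : {set T}, l \in lines -> m \in lines -> l != m ->
    exists! x : T, x \in l /\ x \in m;
  quadrangle : exists A : {set T},
    #|A| = 4 /\ (forall l, l \in lines -> #|A :&: l| <= 2)
}.

Definition has_order (T : finType) (Pi : projective_plane T) (q : nat) : Prop :=
  forall l, l \in lines Pi -> #|l| = q.+1.

Section PlaneMatroid.
Variables (T : finType) (Pi : projective_plane T).

Definition collinear (A : {set T}) : bool := [exists l in lines Pi, A \subset l].

Definition plane_indep (A : {set T}) : bool :=
  (#|A| <= 2) || (#|A| == 3) && ~~ collinear A.

Lemma plane_indep_card A : plane_indep A -> #|A| <= 3.
Proof. by case/orP=> [/leqW|/andP[/eqP->]]. Qed.

Lemma plane_indep0 : plane_indep set0.
Proof. by rewrite /plane_indep cards0. Qed.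

Lemma plane_indepS (A B : {set T}) :
  A \subset B -> plane_indep B -> plane_indep A.
Proof.
move=> sAB iB; have [A2|A3] := leqP #|A| 2; first by rewrite /plane_indep A2.
suff -> : A = B by [].
by apply/eqP; rewrite eqEcard sAB (leq_trans (plane_indep_card iB)).
Qed.

Lemma line2 (A : {set T}) : #|A| = 2 ->
  exists2 l, l \in lines Pi & A \subset l /\
    (forall m, m \in lines Pi -> A \subset m -> m = l).
Proof.
move/eqP/cards2P => [x [y [nxy ->]]].
have [l [[lL xl yl] lU]] := line_through Pi nxy.
exists l => //; split; first by rewrite subUset !sub1set xl.
by move=> m mL; rewrite subUset !sub1set => /andP[xm ym]; apply/esym/lU.
Qed.

Lemma indep_ext (A l : {set T}) x : #|A| = 2 -> l \in lines Pi ->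
  A \subset l -> x \notin l -> plane_indep (x |: A).
Proof.
move=> A2 lL sAl xl.
have xA : x \notin A by apply: contra xl; apply: (subsetP sAl).
rewrite /plane_indep cardsU1 xA A2 /=; apply/existsP => -[m /andP[mL]].
rewrite subUset sub1set => /andP[xm sAm].
have [k _ [_ kU]] := line2 A2.
by rewrite (kU _ lL sAl) -(kU _ mL sAm) xm in xl.
Qed.

Lemma plane_indep_aug (A B : {set T}) :
  plane_indep A -> plane_indep B -> #|A| < #|B| ->
  exists2 x, x \in B :\: A & plane_indep (x |: A).
Proof.
move=> iA iB ltAB; have [A1|A2] := leqP #|A| 1.
  have /subsetPn[x xB xA] : ~~ (B \subset A).
    by apply: contraL ltAB => /subset_leq_card; rewrite -leqNgt.
  by exists x; rewrite ?inE ?xA // /plane_indep cardsU1 xA ltnS A1.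
have B3 : #|B| = 3.
  by apply/eqP; rewrite eqn_leq plane_indep_card // (leq_ltn_trans A2).
have {ltAB} {}A2 : #|A| = 2.
  by apply/eqP; rewrite eqn_leq A2 andbT -ltnS -B3.
have [l lL [sAl _]] := line2 A2.
move: iB; rewrite /plane_indep B3 /= negb_exists => /forallP/(_ l).
rewrite lL => /subsetPn[x xB xl]; exists x; last exact: indep_ext lL sAl xl.
by rewrite inE xB andbT; apply: contra xl; apply: (subsetP sAl).
Qed.

Definition plane_matroid : matroid T :=
  Matroid plane_indep0 plane_indepS plane_indep_aug.

(* [plane_matroid] is the rank-3 simple matroid whose rank-2 flats are the
   lines of the plane: this is the content of the next three lemmas. *)

Lemma plane_matroid_rank : mrank plane_matroid setT = 3.
Proof.
apply/eqP; rewrite eqn_leq; apply/andP; split.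
  by apply: mrank_leq => I _; apply: plane_indep_card.
have [A [A4 Al]] := quadrangle Pi.
have /card_gt0P[x xA] : 0 < #|A| by rewrite A4.
have B3 : #|A :\ x| = 3 by move: A4; rewrite (cardsD1 x) xA => -[].
rewrite -B3; apply: leq_mrank; first exact: subsetT.
rewrite /= /plane_indep B3 /=; apply/existsP => -[l /andP[lL sl]].
have := Al l lL; rewrite leqNgt -B3 => /negP; apply.
by apply/subset_leq_card; rewrite subsetI subD1set.
Qed.

Lemma plane_matroid_simple : simple_matroid plane_matroid.
Proof.
move=> C /minsetP[nC _]; rewrite ltnNge; apply: contra nC => C2.
by rewrite /= /plane_indep C2.
Qed.

Lemma plane_matroid_lines q : 0 < q -> has_order Pi q -> forall F : {set T},
  (flat plane_matroid F && (mrank plane_matroid F == 2)) = (F \in lines Pi).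
Proof.
move=> q0 oq F.
have rk2 l : l \in lines Pi -> mrank plane_matroid l = 2.
  move=> lL; apply/eqP; rewrite eqn_leq; apply/andP; split.
    apply: mrank_leq => I sIl /orP[//|/andP[_ /existsP[]]].
    by exists l; rewrite lL.
  have /card_gt1P[x [y [xl yl nxy]]] : 1 < #|l| by rewrite oq.
  have <- : #|[set x; y]| = 2 by rewrite cards2 nxy.
  apply: leq_mrank; first by rewrite subUset !sub1set xl.
  by rewrite /= /plane_indep cards2 nxy.
apply/andP/idP => [[/forallP fF /eqP rF]|FL]; last first.
  split; last by rewrite rk2.
  apply/forallP => x; apply/implyP => xF; rewrite rk2 //.
  have [I [sIF _]] := mrank_witness plane_matroid F; rewrite rk2 // => I2.
  have xI : x \notin I by apply: contra xF; apply: (subsetP sIF).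
  have <- : #|x |: I| = 3 by rewrite cardsU1 xI I2.
  apply: leq_mrank; first exact: setUS.
  exact: indep_ext I2 FL sIF xF.
have [I [sIF iI]] := mrank_witness plane_matroid F; rewrite rF => I2.
have [l lL [sIl _]] := line2 I2.
have sFl : F \subset l.
  apply/subsetP => x xF; apply/negPn/negP => xl.
  suff : 3 <= 2 by [].
  have xI : x \notin I by apply: contra xl; apply: (subsetP sIl).
  rewrite -[X in _ <= X]rF; have <- : #|x |: I| = 3 by rewrite cardsU1 xI I2.
  apply: leq_mrank; first by rewrite subUset sub1set xF.
  exact: indep_ext I2 lL sIl xl.
suff -> : F = l by [].
apply/eqP; rewrite eqEsubset sFl /=; apply/subsetP => x xl.
apply: contraT => xF; have := fF x; rewrite xF rF /= ltnNge => /negP[].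
rewrite -(rk2 l lL); apply: mrank_leq => J sJ iJ; apply: leq_mrank => //.
by apply: subset_trans sJ _; rewrite subUset sub1set xl.
Qed.

End PlaneMatroid.

(* Main.v *)
Require Import Defs.
From mathcomp Require Import all_boot.

(** The Hamiltonian circuits are the quadrangles, the sets of four points that
    meet every line in at most two points ([hamiltonian_plane]).

    For the upper bound, colours are irrelevant: any [q + 3] points contain a
    quadrangle ([quadrangle_in_large_set]), hence so does a set of
    representatives of the [q + 3] colours.  If no line carries three of the
    points, any four of them will do.  If a line [l] does, it holds at most
    [q + 1] of them, which leaves two points [x], [y] off [l]; the line [xy]
    takes at most one point from [l], so two of the chosen points on [l] remain
    to complete [x], [y] to a quadrangle.

    For the lower bound, give the [q + 1] points of a line distinct colours and
    all other points one further colour.  A quadrangle has two points off the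
    line, so it repeats a colour.  Merging colours keeps this property, which
    covers every smaller number of colours ([line_colouring]). *)

Section Plane.
Set Implicit Arguments.
Unset Strict Implicit.
Variables (T : finType) (Pi : projective_plane T).

(** The sequence form turns the incidence of four explicit points with a line
    into a computation on four booleans. *)
Lemma card_seq_setI (s : seq T) (k : {set T}) :
  #|[set z in s] :&: k| <= count (mem k) s.
Proof.
rewrite -size_filter; apply: leq_trans (card_size _).
by apply/subset_leq_card/subsetP => z; rewrite !inE mem_filter andbC.
Qed.

Lemma line_eq (l m : {set T}) x y : x != y -> l \in lines Pi -> m \in lines Pi ->
  x \in l -> y \in l -> x \in m -> y \in m -> l = m.
Proof.
move=> nxy lL mL xl yl xm ym; have [k [_ kU]] := line_through Pi nxy.
by rewrite -(kU l) ?(kU m).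
Qed.

Lemma hamiltonian_plane (C : {set T}) :
  reflect (#|C| = 4 /\ forall l, l \in lines Pi -> #|C :&: l| <= 2)
          (hamiltonian_circuit (plane_matroid Pi) C).
Proof.
rewrite /hamiltonian_circuit plane_matroid_rank.
apply: (iffP andP) => [[/minsetP[_ minC] /eqP C4]|[C4 Cl]]; split=> //.
  (* Three points of [C] on a line would be a smaller dependent set. *)
  move=> l lL; rewrite leqNgt; apply/negP => /card_geqP[s [us s3 sCl]].
  have A3 : #|[set z in s]| = 3 by rewrite cardsE (card_uniqP us).
  suff E : [set z in s] = C by move: A3; rewrite E C4.
  apply: minC.
    rewrite /= /plane_indep A3 /= negbK; apply/existsP; exists l.
    by rewrite lL; apply/subsetP => z; rewrite inE => /sCl; rewrite inE => /andP[].
  by apply/subsetP => z; rewrite inE => /sCl; rewrite inE => /andP[].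
apply/minsetP; split=> [|B]; first by rewrite /= /plane_indep C4.
  move=> dB sBC; apply/eqP; rewrite eqEcard sBC C4 ltnNge; apply/negP => B3.
  move: dB; rewrite /= /plane_indep negb_or -ltnNge => /andP[B2].
  have -> : #|B| == 3 by rewrite eqn_leq B3 B2.
  rewrite negbK => /existsP[l /andP[lL sBl]].
  have := leq_trans B2 (subset_leq_card (_ : B \subset C :&: l)).
  by rewrite subsetI sBC sBl ltnNge Cl // => /(_ isT).
by rewrite C4.
Qed.

Lemma quadrangle_of_two_pairs (l m : {set T}) a b x y :
  l \in lines Pi -> m \in lines Pi -> a != b -> x != y ->
  a \in l -> b \in l -> x \notin l -> y \notin l ->
  x \in m -> y \in m -> a \notin m -> b \notin m ->
  hamiltonian_circuit (plane_matroid Pi) [set z in [:: a; b; x; y]].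
Proof.
move=> lL mL nab nxy al bl xl yl xm ym am bm.
have ne u v (A : {set T}) : u \in A -> v \notin A -> u != v.
  by move=> uA; apply: contraNneq => <-.
apply/hamiltonian_plane; split.
  rewrite cardsE; apply/card_uniqP; rewrite /= !inE !negb_or nab nxy.
  by rewrite !(ne _ _ l).
move=> k kL; apply: leq_trans (card_seq_setI _ _) _; rewrite /= addn0.
(* A line through three of the points contains both [a] and [b], so is [l], or
   both [x] and [y], so is [m]. *)
have abk : a \in k -> b \in k -> (x \notin k) && (y \notin k).
  by move=> ak bk; rewrite (line_eq nab kL lL) ?xl ?yl.
have xyk : x \in k -> y \in k -> (a \notin k) && (b \notin k).
  by move=> xk yk; rewrite (line_eq nxy kL mL) ?am ?bm.
move: abk xyk.
case: (a \in k); case: (b \in k); case: (x \in k); case: (y \in k) => //= abk xyk;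
  by [have := abk isT isT | have := xyk isT isT].
Qed.

Lemma line_meet_card (l m : {set T}) : l \in lines Pi -> m \in lines Pi ->
  l != m -> #|l :&: m| <= 1.
Proof.
move=> lL mL nlm; have [p [_ pU]] := line_meet lL mL nlm.
rewrite -(cards1 p); apply/subset_leq_card/subsetP => z.
by rewrite !inE => /andP[zl zm]; rewrite (pU z).
Qed.

(** The bound is sharp: a line and one further point form a set of [q + 2]
    points in which any four points include three collinear ones. *)
Lemma quadrangle_in_large_set q (S : {set T}) : 0 < q -> has_order Pi q ->
  q + 3 <= #|S| ->
  exists2 C : {set T}, C \subset S & hamiltonian_circuit (plane_matroid Pi) C.
Proof.
move=> q0 oq S3.
case: (boolP [exists l in lines Pi, 2 < #|S :&: l|]) => [|noline]; last first.
  have /card_geqP[s [us s4 sS]] : 4 <= #|S|.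
    by apply: leq_trans S3; rewrite -(leq_add2r 3) in q0.
  exists [set z in s]; first by apply/subsetP => z; rewrite inE; apply: sS.
  apply/hamiltonian_plane; split; first by rewrite cardsE (card_uniqP us).
  move=> l lL; rewrite leqNgt; apply: contra noline => h.
  apply/existsP; exists l; rewrite lL; apply: leq_trans h _.
  by apply/subset_leq_card/setSI/subsetP => z; rewrite inE; apply: sS.
case/existsP=> l /andP[lL Sl].
have /card_gt1P[x [y []]] : 1 < #|S :\: l|.
  have := leq_trans S3 (eq_leq (esym (cardsID l S))).
  have := subset_leq_card (subsetIr S l); rewrite (oq l lL) => h1 h2.
  by rewrite -(leq_add2l q.+1) addSnnS (leq_trans h2) ?leq_add2r.
rewrite !inE => /andP[xl xS] /andP[yl yS] nxy.
have [m [[mL xm ym] _]] := line_through Pi nxy.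
have nlm : l != m by apply: contraNneq xl => ->.
have /card_gt1P[a [b []]] : 1 < #|(S :&: l) :\: m|.
  have h : #|S :&: l :&: m| <= 1.
    apply: leq_trans (line_meet_card lL mL nlm).
    by apply/subset_leq_card/setSI/subsetIr.
  by rewrite -(cardsID m) in Sl; rewrite -(leq_add2l 1) (leq_trans Sl) ?leq_add2r.
rewrite !inE => /and3P[am aS al] /and3P[bm bS bl] nab.
exists [set z in [:: a; b; x; y]]; last exact: (@quadrangle_of_two_pairs l m).
by apply/subsetP => z; rewrite !inE => /or4P[] /eqP->.
Qed.

Lemma quadrangle_off_line (C l : {set T}) : l \in lines Pi ->
  #|C| = 4 -> (forall k, k \in lines Pi -> #|C :&: k| <= 2) -> 1 < #|C :\: l|.
Proof.
move=> lL C4 /(_ l lL) h.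
by rewrite -(leq_add2l 2) -[_ + _]C4 -(cardsID l C) leq_add2r.
Qed.

Lemma ex_line : exists l, l \in lines Pi.
Proof.
have [A [A4 _]] := quadrangle Pi.
have /card_gt1P[x [y [_ _ nxy]]] : 1 < #|A| by rewrite A4.
by have [l [[lL _ _] _]] := line_through Pi nxy; exists l.
Qed.

(** The points off a line share one colour, which every quadrangle uses at
    least twice; the points on the line supply the other [t] colours. *)
Lemma line_colouring q t : has_order Pi q -> t <= q.+1 ->
  ~~ all_heterochromatic (HC (plane_matroid Pi)) t.+1.
Proof.
move=> oq tq; have [l lL] := ex_line.
have szl : size (enum l) = q.+1 by rewrite -cardE oq.
(* Truncating at [t] merges the colours in excess; since a point off [l] has
     index [q.+1] in [enum l], all such points get the last colour [t]. *)
pose phi : {ffun T -> 'I_t.+1} := [ffun v => inord (minn (index v (enum l)) t)].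
have phi_off v : v \notin l -> phi v = ord_max.
  move=> vl; rewrite ffunE memNindex ?mem_enum // szl (minn_idPr tq).
  by apply: val_inj; rewrite /= inordK.
apply/forallPn; exists phi; rewrite negb_imply; apply/andP; split.
  apply/forallP => c; apply/existsP.
  have [ct|tc] := ltnP c t.
    have cl : c < size (enum l) by rewrite szl (leq_trans ct).
    have /card_gt0P[v0 _] : 0 < #|l| by rewrite oq.
    exists (nth v0 (enum l) c); rewrite ffunE index_uniq ?enum_uniq //.
    by rewrite (minn_idPl (ltnW ct)) inord_val.
  have [A [A4 Al]] := quadrangle Pi.
  have /card_gt0P[v] := ltnW (quadrangle_off_line lL A4 Al).
  rewrite inE => /andP[vl _]; exists v; rewrite phi_off // -val_eqE /=.
  by rewrite eqn_leq tc -ltnS ltn_ord.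
apply/existsPn => C; rewrite inE; apply/negP => /andP[/hamiltonian_plane[C4 Cl]].
move/dinjectiveP => injC.
have /card_gt1P[x [y []]] := quadrangle_off_line lL C4 Cl.
rewrite !inE => /andP[xl xC] /andP[yl yC] /eqP[].
by apply: injC; rewrite // !phi_off.
Qed.

End Plane.

(** A set of representatives of the colour classes has [t] points, and every
    hyperedge inside it is totally multicoloured. *)
Lemma heterochromatic_of_large (T : finType) (H : hypergraph T) t :
  (forall S : {set T}, t <= #|S| -> exists2 C : {set T}, C \subset S & C \in H) ->
  all_heterochromatic H t.
Proof.
move=> large; apply/forallP => phi; apply/implyP => /forallP surj.
have surj' c : exists v, phi v == c by apply/existsP.
pose g c := xchoose (surj' c).
have gK : cancel g phi by move=> c; apply/eqP/(xchooseP (surj' c)).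
have [|C sCS CH] := large (g @: setT).
  by rewrite card_imset ?cardsT ?card_ord //; apply: can_inj gK.
apply/existsP; exists C; rewrite CH; apply/dinjectiveP => x y xC yC.
have /imsetP[c _ ->] := subsetP sCS x xC.
have /imsetP[d _ ->] := subsetP sCS y yC.
by rewrite !gK => ->.
Qed.

Theorem theorem4p5 (q : nat) (T : finType) (Pi : projective_plane T) :
  1 < q -> has_order Pi q -> hc (HC (plane_matroid Pi)) = q + 3.
Proof.
move=> q1 oq; rewrite /hc; case: ex_minnP => n /andP[n0 hn] nmin.
apply/eqP; rewrite eqn_leq nmin /=; last first.
  rewrite addn_gt0 orbT; apply: heterochromatic_of_large => S S3.
  have [C sCS hC] := quadrangle_in_large_set (ltnW q1) oq S3.
  by exists C; rewrite ?inE.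
rewrite leqNgt; apply/negP; case: n n0 hn {nmin} => // t _ hn tq.
have {}tq : t <= q.+1 by move: tq; rewrite addn3 !ltnS.
by case/negP: (line_colouring oq tq).
Qed.
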